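(* Let $A$ be a $C^*$-algebra and let $K, L \subseteq A$ be Lie ideals. Then $[K,L]$ generates $A$ as a not necessarily closed ideal if and only if both $[K,K]$ and $[L,L]$ (each of them separately) generate $A$ as a not necessarily closed ideal. Moreover, if this is the case, then $[A,A] = [K,L]$.
   Context: $C^*$-algebras are not assumed to be unital. For subsets $X, Y$ of a $C^*$-algebra, $[X,Y]$ denotes the linear span (no closure) of the set of commutators $[x,y] := xy - yx$ with $x \in X$, $y \in Y$. A (not necessarily closed) linear subspace $L \subseteq A$ is a Lie ideal if $[A,L] \subseteq L$. Ideals are two-sided and not necessarily closed. A subspace $M \subseteq A$ generates $A$ as a not necessarily closed ideal if the (algebraic) ideal generated by $M$, namely $\widetilde{A}M\widetilde{A} = M + AM + MA + AMA$, equals $A$; here $\widetilde{A}$ is the minimal unitization of $A$ (with $\widetilde{A} = A$ if $A$ is unital), and products of subsets denote linear spans of the sets of products. *)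

(* Defs.v *)
From HB Require Import structures.
From mathcomp Require Import all_boot all_order all_algebra.
From mathcomp Require Import all_classical all_reals all_analysis.
From mathcomp Require Import complex.

Set Implicit Arguments.
Unset Strict Implicit.
Unset Printing Implicit Defensive.

Import Order.TTheory GRing.Theory Num.Theory.
Import numFieldNormedType.Exports.

Local Open Scope classical_set_scope.
Local Open Scope ring_scope.
Local Open Scope complex_scope.

(* C*-algebras without unit assumption. The multiplication is a new operation
   because the ring structures of MathComp all carry a unit. The norm takes
   values in R[i]; being nonnegative, these values are real. *)
HB.mixin Record CompleteNormedModule_isCStarAlgebra (R : realType) A
    of CompleteNormedModule R[i] A := {
  cmul : A -> A -> A ;
  cstar : A -> A ;
  cmulA : associative cmul ;
  cmulDl : forall x y z : A, cmul (x + y) z = cmul x z + cmul y z ;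
  cmulDr : forall x y z : A, cmul x (y + z) = cmul x y + cmul x z ;
  cscalerAl : forall (a : R[i]) (x y : A), a *: cmul x y = cmul (a *: x) y ;
  cscalerAr : forall (a : R[i]) (x y : A), a *: cmul x y = cmul x (a *: y) ;
  cstarK : involutive cstar ;
  cstarD : forall x y : A, cstar (x + y) = cstar x + cstar y ;
  cstarZ : forall (a : R[i]) (x : A), cstar (a *: x) = a^* *: cstar x ;
  cstarM : forall x y : A, cstar (cmul x y) = cmul (cstar y) (cstar x) ;
  cnormM : forall x y : A, `|cmul x y| <= `|x| * `|y| ;
  cnorm_star : forall x : A, `|cmul (cstar x) x| = `|x| ^+ 2
}.

#[short(type="cstarAlgType")]
HB.structure Definition CStarAlgebra (R : realType) :=
  {A of CompleteNormedModule_isCStarAlgebra R A & CompleteNormedModule R[i] A}.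

Section LieIdeals.
Context {R : realType} {A : cstarAlgType R}.
Implicit Types (x y : A) (X Y L M : set A).

Definition linear_subspace L : Prop :=
  L 0 /\ forall (a : R[i]) x y, L x -> L y -> L (a *: x + y).

Definition lin_span X : set A :=
  [set v | exists n (a : 'I_n -> R[i]) (x : 'I_n -> A),
    (forall i, X (x i)) /\ v = \sum_(i < n) a i *: x i].

Definition commutator x y : A := cmul x y - cmul y x.

Definition comm_span X Y : set A :=
  lin_span [set commutator x y | x in X & y in Y].

Definition prod_span X Y : set A :=
  lin_span [set cmul x y | x in X & y in Y].

Definition sum_set X Y : set A := [set x + y | x in X & y in Y].

Definition lie_ideal L : Prop :=
  linear_subspace L /\ comm_span setT L `<=` L.

(* M + AM + MA + AMA, which is the two-sided ideal generated by M
   when M is a linear subspace. *)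
Definition alg_ideal M : set A :=
  sum_set (sum_set (sum_set M (prod_span setT M)) (prod_span M setT))
    (prod_span (prod_span setT M) setT).

Definition generates_as_ideal M : Prop := alg_ideal M = setT.

End LieIdeals.

(* Main.v *)
(* The prime radical of a ring is nil, so an ideal J of A lies in a proper prime
   ideal as soon as some b has no power in J. For a selfadjoint x outside J such
   a b exists by a Cohen-type factorization: b is an infinite product of
   functions of x decaying so slowly at 0 that every power of b divides x.
   Hence a subspace generates A if and only if no proper prime ideal contains
   it. Modulo a prime ideal, Herstein's arguments show that [K, L] = 0 forces K
   or L to be central and that [K, L] vanishes if it is central, which gives the
   equivalence. For M = [K, L] it follows that [M, M] generates A, so that
   A = M + M^2 and [A, A] = [A, M], which is contained in M. *)

Require Import Defs.
From HB Require Import structures.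
From mathcomp Require Import all_boot all_order all_algebra.
From mathcomp Require Import all_classical all_reals all_analysis.
From mathcomp Require Import complex ring zify.

Set Implicit Arguments.
Unset Strict Implicit.
Unset Printing Implicit Defensive.

Import Order.TTheory GRing.Theory Num.Theory.
Import numFieldNormedType.Exports.

Local Open Scope classical_set_scope.
Local Open Scope ring_scope.
Local Open Scope complex_scope.

(** * Linear identities *)

(* The square-zero extension of C by V is a commutative ring containing V, so
   that [ring] decides the linear identities of V. *)
Section SquareZeroExtension.
Context (C : comNzRingType) (V : lmodType C).

Definition sqzero : Type := (C * V)%type.
HB.instance Definition _ := GRing.Zmodule.copy sqzero (C * V)%type.

Implicit Types u v w : sqzero.

Definition sqzero_mul u v : sqzero := (u.1 * v.1, u.1 *: v.2 + v.1 *: u.2).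
Definition sqzero_one : sqzero := (1, 0).

Lemma sqzero_mulA : associative sqzero_mul.
Proof.
move=> [a x] [b y] [c z]; congr pair; first by rewrite /= mulrA.
rewrite /= !scalerDr !scalerA addrA.
by rewrite (mulrC a c) (mulrC a b) (mulrC b c) mulrC.
Qed.

Lemma sqzero_mulC : commutative sqzero_mul.
Proof. by move=> [a x] [b y]; rewrite /sqzero_mul /= mulrC addrC. Qed.

Lemma sqzero_mul1 : left_id sqzero_one sqzero_mul.
Proof. by case=> [a x]; rewrite /sqzero_mul /= mul1r scale1r scaler0 addr0. Qed.

Lemma sqzero_mulDl : left_distributive sqzero_mul +%R.
Proof.
move=> [a x] [b y] [c z]; congr pair; rewrite /= ?mulrDl //.
by rewrite scalerDl scalerDr addrACA.
Qed.

Lemma sqzero_one_neq0 : sqzero_one != 0.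
Proof. by rewrite xpair_eqE /= oner_eq0. Qed.

HB.instance Definition _ := GRing.Zmodule_isComNzRing.Build sqzero
  sqzero_mulA sqzero_mulC sqzero_mul1 sqzero_mulDl sqzero_one_neq0.

Definition sqz_vec (x : V) : sqzero := (0, x).
Definition sqz_scal (a : C) : sqzero := (a, 0).

Lemma sqz_vec_inj : injective sqz_vec.
Proof. by move=> x y []. Qed.

Lemma sqz_vecD x y : sqz_vec (x + y) = sqz_vec x + sqz_vec y.
Proof. by congr pair; rewrite /= addr0. Qed.

Lemma sqz_vecN x : sqz_vec (- x) = - sqz_vec x.
Proof. by congr pair; rewrite /= oppr0. Qed.

Lemma sqz_vec0 : sqz_vec 0 = 0.
Proof. by []. Qed.

Lemma sqz_vecMn x n : sqz_vec (x *+ n) = sqz_vec x *+ n.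
Proof.
by elim: n => [|n IHn]; rewrite ?mulr0n ?sqz_vec0 // !mulrS sqz_vecD IHn.
Qed.

Lemma sqz_vecZ a x : sqz_vec (a *: x) = sqz_scal a * sqz_vec x.
Proof. by congr pair; rewrite /= ?mulr0 // scale0r addr0. Qed.

Lemma sqz_scalD a b : sqz_scal (a + b) = sqz_scal a + sqz_scal b.
Proof. by congr pair; rewrite /= addr0. Qed.

Lemma sqz_scalN a : sqz_scal (- a) = - sqz_scal a.
Proof. by congr pair; rewrite /= oppr0. Qed.

Lemma sqz_scalM a b : sqz_scal (a * b) = sqz_scal a * sqz_scal b.
Proof. by congr pair; rewrite /= scaler0 ?scaler0 ?addr0. Qed.

Lemma sqz_scal1 : sqz_scal 1 = 1.
Proof. by []. Qed.

Lemma sqz_scalMn a n : sqz_scal (a *+ n) = sqz_scal a *+ n.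
Proof.
by elim: n => [|n IHn]; rewrite ?mulr0n // !mulrS sqz_scalD IHn.
Qed.

Definition sqzE := (sqz_vecD, sqz_vecN, sqz_vec0, sqz_vecMn, sqz_vecZ,
  sqz_scalD, sqz_scalN, sqz_scalM, sqz_scal1, sqz_scalMn).

End SquareZeroExtension.

Ltac lin_ring := apply: sqz_vec_inj; rewrite ?sqzE; ring.

Section Multiplication.
Context {R : realType} {A : cstarAlgType R}.
Implicit Types (x y z : A).

Lemma cmul0r y : cmul 0 y = 0.
Proof. by apply: (addrI (cmul 0 y)); rewrite -cmulDl !addr0. Qed.

Lemma cmulr0 x : cmul x 0 = 0.
Proof. by apply: (addrI (cmul x 0)); rewrite -cmulDr !addr0. Qed.

Lemma cmulNr x y : cmul (- x) y = - cmul x y.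
Proof. by apply/eqP; rewrite -addr_eq0 -cmulDl addNr cmul0r. Qed.

Lemma cmulrN x y : cmul x (- y) = - cmul x y.
Proof. by apply/eqP; rewrite -addr_eq0 -cmulDr addNr cmulr0. Qed.

Definition cmulE := (@cmulDl R A, @cmulDr R A, cmulNr, cmulrN, @cmulA R A).
End Multiplication.

(** Products are expanded into left-bracketed monomials, after which the identity is linear in these
    monomials. *)
Ltac nc_ring := rewrite /commutator ?cmulE; lin_ring.

(** * Geometric convergence *)

Section Geometric.
Context {R : realType}.
Local Notation C := R[i].
Local Notation half := (2^-1 : C).

Lemma half_gt0 : 0 < half. Proof. by rewrite invr_gt0. Qed.
Lemma half_ge0 : 0 <= half. Proof. exact: ltW half_gt0. Qed.
Lemma halfX_gt0 k : 0 < half ^+ k. Proof. exact: exprn_gt0 half_gt0. Qed.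
Lemma halfX_ge0 k : 0 <= half ^+ k. Proof. exact: ltW (halfX_gt0 k). Qed.
Lemma half_split : 1 = half + half.
Proof. by rewrite [LHS]splitr mul1r. Qed.
Lemma halfX_split k : half ^+ k = half ^+ k.+1 + half ^+ k.+1.
Proof. by rewrite exprS -mulrDl -half_split mul1r. Qed.
Lemma halfX_le1 k : half ^+ k <= 1.
Proof.
by rewrite exprn_ile1 // ?half_ge0 // [leRHS]half_split lerDl half_ge0.
Qed.
Lemma halfX_le j k : (j <= k)%N -> half ^+ k <= half ^+ j.
Proof.
by move=> /subnK <-; rewrite exprD ler_piMl ?halfX_ge0 ?halfX_le1.
Qed.

(** As [R[i]] is only partially ordered, the Archimedean bound is taken for the real number c / e;
    then n < 2^n suffices. *)
Lemma geometric_small (c e : C) : 0 <= c -> 0 < e ->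
  exists k, c * half ^+ k < e.
Proof.
move=> c0 e0; pose r := complex.Re (c / e).
have ce : c / e = r%:C by rewrite /r RRe_real // ger0_real // divr_ge0 // ltW.
have r0 : 0 <= r by rewrite -lecR -ce divr_ge0 // ltW.
exists (Num.bound r).
have := archi_boundP r0; set n := Num.bound r => rn.
have {rn}: c / e < n%:R.
  rewrite ce; move: rn; rewrite -ltcR => /lt_le_trans; apply.
  by rewrite rmorph_nat.
rewrite ltr_pdivrMr // => cn.
apply: (@lt_le_trans _ _ (n%:R * e * half ^+ n)).
  by rewrite ltr_pM2r // halfX_gt0.
rewrite mulrAC ler_piMl ?(ltW e0) //.
rewrite exprVn ler_pdivrMr ?exprn_gt0 // mul1r -natrX ler_nat.
exact: ltnW (ltn_expl _ _).
Qed.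

(** Equalities between limits are proved through this criterion, by explicit error bounds instead of
    continuity. *)
Lemma le_geometric_eq0 (V : normedModType C) (v : V) (c : C) :
  (forall k, `|v| <= c * half ^+ k) -> v = 0.
Proof.
move=> vc; apply/eqP; rewrite -normr_eq0; apply/eqP/le_anti.
rewrite normr_ge0 andbT.
have c0 : 0 <= c.
  by have := vc 0%N; rewrite expr0 mulr1; exact: le_trans.
case: (eqVneq v 0) => [->|v0]; first by rewrite normr0.
have /(geometric_small c0)[k ck] : 0 < `|v| by rewrite normr_gt0.
by have := le_lt_trans (vc k) ck; rewrite ltxx.
Qed.

Lemma geometric_cvg (V : completeNormedModType C) (u : nat -> V) (c : C) :
  (forall k, `|u k.+1 - u k| <= c * half ^+ k) ->
  exists l d, forall k, `|u k - l| <= d * half ^+ k.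
Proof.
move=> uc.
have c0 : 0 <= c 
  by have := uc 0%N; rewrite expr0 mulr1; exact: le_trans.
have c20 : 0 <= c * 2 by rewrite mulr_ge0.
have ukn k n : `|u (k + n)%N - u k| <= c * 2 * half ^+ k.
  (* The telescoped form of the bound is the one that survives the induction on [n]. *)
  suff: `|u (k + n)%N - u k| <= c * 2 * (half ^+ k - half ^+ (k + n)).
    move=> /le_trans; apply; apply: ler_wpM2l => //.
    by rewrite gerDl oppr_le0 halfX_ge0.
  elim: n => [|n IHn]; first by rewrite addn0 !subrr normr0 mulr0.
  rewrite -(subrKA (u (k + n)%N)); apply: le_trans (ler_normD _ _) _.
  have ukn := uc (k + n)%N; rewrite -addnS in ukn.
  apply: le_trans (lerD ukn IHn) _.
  rewrite addnS (halfX_split (k + n)).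
  by rewrite le_eqVlt; apply/orP; left; apply/eqP; ring.
have : cvg (u @ \oo).
  apply/cauchy_cvgP/cauchy_exP => e e0.
  have [k ck] := geometric_small c20 e0.
  exists (u k); exists k => // n /= /subnKC <-.
  by rewrite -ball_normE /= distrC; apply: le_lt_trans (ukn _ _) ck.
(* The extra 1 pays for a late term of the sequence, which lies within 2^-k of the limit. *)
move=> /cvg_ex[l ul]; exists l, (c * 2 + 1) => k.
have lk : nbhs l (ball l (half ^+ k)) by apply: nbhsx_ballx; exact: halfX_gt0.
have [N _ HN] := ul _ lk.
have := HN (k + N)%N (leq_addl _ _); rewrite /= -ball_normE /= => lN.
rewrite mulrDl mul1r -(subrKA (u (k + N)%N)); apply: le_trans (ler_normD _ _) _.
by apply: lerD; [rewrite distrC; exact: ukn | rewrite distrC; exact: ltW].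
Qed.
End Geometric.

(** * Cayley transforms of selfadjoint elements *)

Section CStar.
Context {R : realType} {A : cstarAlgType R}.
Implicit Types (x y z w p q : A) (c : R[i]).
Local Notation half := (2^-1 : R[i]).

Lemma cstarN x : cstar (- x) = - cstar x.
Proof. by rewrite -scaleN1r cstarZ rmorphN1 scaleN1r. Qed.

(** The C*-identity bounds |x|^2 by |cstar x| |x|, and a nonzero |x| cancels. *)
Lemma ler_cnorm_cstar x : `|x| <= `|cstar x|.
Proof.
have [->|x0] := eqVneq x 0; first by rewrite normr0.
have := cnormM (cstar x) x.
by rewrite cnorm_star expr2 ler_pM2r // normr_gt0.
Qed.

Lemma cnorm_cstar x : `|cstar x| = `|x|.
Proof.
by apply/le_anti; rewrite ler_cnorm_cstar -{2}[x]cstarK ler_cnorm_cstar.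
Qed.

Lemma cnormMl_le1 x p : `|p| <= 1 -> `|cmul x p| <= `|x|.
Proof. by move=> p1; apply: le_trans (cnormM _ _) _; rewrite ler_piMr. Qed.

(** Test [q] on [cstar q]: by the C*-identity this product has norm |q|^2. *)
Lemma lmul_contraction_norm q :
  (forall y, `|cmul q y| <= `|y|) -> `|q| <= 1.
Proof.
move=> q1; have [->|q0] := eqVneq q 0; first by rewrite normr0.
have := q1 (cstar q).
rewrite -{1}[q]cstarK cnorm_star cnorm_cstar expr2.
by rewrite ger_pMl ?normr_gt0.
Qed.

Lemma half_scale_sum y z : y + y = z -> y = half *: z.
Proof.
by move=> <-; rewrite scalerDr -scalerDl -half_split scale1r.
Qed.

Section Cayley.
Variables (x q : A) (c : R[i]).
Hypotheses (xsa : cstar x = x) (c0 : c != 0) (cim : c^*%R = - c).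
Hypothesis xq : x = cmul x q + c *: q.

(* [q = x / (x + c)], so that [2 q - 1 = (x - c) / (x + c)] is the Cayley
   transform of [x], which is unitary. *)
Lemma cayley_unitary : cmul (cstar q) q + cmul (cstar q) q = q + cstar q.
Proof.
have qx : cmul (cstar q) x = x + c *: cstar q.
  have h := congr1 (@cstar R A) xq.
  by rewrite cstarD cstarM cstarZ cim xsa in h; rewrite {2}h; lin_ring.
(* Multiply [xq] by [cstar q] on the left and expand with [qx]; once x is replaced by x q + c q, the
   term x q cancels. *)
apply: (scalerI c0).
have : cmul (cstar q) (cmul x q + c *: q) = x + c *: cstar q by rewrite -xq.
rewrite cmulDr cmulA qx cmulDl -!cscalerAl -cscalerAr => h.
have {}h : cmul x q + (c *: cmul (cstar q) q + c *: cmul (cstar q) q)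
    = cmul x q + (c *: q + c *: cstar q).
  by rewrite addrA h {1}xq addrA.
by move/addrI: h => h; rewrite !scalerDr.
Qed.

(** Without a unit, the unitary 2 q - 1 is present only through its action on [y]. The C*-identity
    reduces the claim to [cayley_unitary]. *)
Lemma cayley_isometry y : `|cmul q y + cmul q y - y| = `|y|.
Proof.
apply/eqP; rewrite -(eqrXn2 (_ : 0 < 2)%N) // -!cnorm_star.
apply/eqP; congr (`|_|).
rewrite !cstarD cstarN cstarM.
transitivity (cmul (cstar y) y + cmul (cmul (cstar y)
   (cmul (cstar q) q + cmul (cstar q) q - (q + cstar q))) y
  + cmul (cmul (cstar y)
   (cmul (cstar q) q + cmul (cstar q) q - (q + cstar q))) y); last first.
  by rewrite cayley_unitary subrr cmulr0 cmul0r !addr0.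
nc_ring.
Qed.

(** 2 q is the sum of the identity and the isometry 2 q - 1; in the next lemma 2 (1 - q) is their
    difference. *)
Lemma cayley_lmul_norm y : `|cmul q y| <= `|y|.
Proof.
have /half_scale_sum -> : cmul q y + cmul q y = (cmul q y + cmul q y - y) + y.
  lin_ring.
rewrite normrZ (ger0_norm half_ge0) ler_pdivrMl ?ltr0n //.
by rewrite (le_trans (ler_normD _ _)) // cayley_isometry mulr_natl mulr2n.
Qed.

Lemma cayley_compl_norm y : `|y - cmul q y| <= `|y|.
Proof.
have /half_scale_sum -> : (y - cmul q y) + (y - cmul q y)
   = y - (cmul q y + cmul q y - y) by lin_ring.
rewrite normrZ (ger0_norm half_ge0) ler_pdivrMl ?ltr0n //.
by rewrite (le_trans (ler_normB _ _)) // cayley_isometry mulr_natl mulr2n.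
Qed.

End Cayley.

(** Banach's fixed point theorem for y |-> p + T y / 2, which replaces inversion in a unital
    algebra. The iteration starts at 0, so commutation with [w] holds for all iterates and passes to
    the limit. *)
Lemma half_contraction_fixpoint (T : A -> A) p :
    {morph T : y z / y - z} -> (forall y, `|T y| <= `|y|) ->
  exists q, q = p + half *: T q /\ forall w, cmul w p = cmul p w ->
    (forall y, cmul w y = cmul y w -> cmul w (T y) = cmul (T y) w) ->
    cmul w q = cmul q w.
Proof.
move=> TB T1; pose f y := p + half *: T y.
have fB y z : `|f y - f z| <= half * `|y - z|.
  rewrite /f opprD addrACA subrr add0r -scalerBr -TB normrZ.
  by rewrite (ger0_norm half_ge0) ler_pM2l ?half_gt0.
pose u k := iter k f 0.
have [|q [d uq]] := @geometric_cvg R A u `|u 1%N - u 0%N|.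
  elim=> [|k IHk]; first by rewrite mulr1.
  rewrite exprS mulrCA; apply: le_trans (fB _ _) _.
  by rewrite ler_pM2l ?half_gt0.
have d0 : 0 <= d by have := uq 0%N; rewrite mulr1; exact: le_trans.
exists q; split=> [|w wp wT].
  apply/eqP; rewrite -subr_eq0; apply/eqP.
  apply: (@le_geometric_eq0 R A _ d) => k.
  rewrite -/(f q) -(subrKA (u k.+1)); apply: le_trans (ler_normD _ _) _.
  rewrite halfX_split mulrDr lerD //; first by rewrite distrC.
  by apply: le_trans (fB _ _) _; rewrite exprS mulrCA ler_pM2l ?half_gt0.
have wu k : cmul w (u k) = cmul (u k) w.
  elim: k => [|k IHk]; first by rewrite cmul0r cmulr0.
  by rewrite /= cmulDr cmulDl -cscalerAr -cscalerAl wT // wp.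
apply/eqP; rewrite -subr_eq0; apply/eqP.
apply: (@le_geometric_eq0 R A _ (d * `|w| + d * `|w|)) => k.
have -> : cmul w q - cmul q w = cmul (u k - q) w - cmul w (u k - q).
  by rewrite cmulDl cmulDr wu; nc_ring.
apply: le_trans (ler_normB _ _) _; rewrite mulrDl; apply: lerD.
  by rewrite (le_trans (cnormM _ _)) // mulrAC ler_wpM2r.
by rewrite (le_trans (cnormM _ _)) // mulrAC mulrC ler_wpM2r.
Qed.

(** Lying in the bicommutant of [x] replaces being a function of [x]; any two such elements
    commute. *)
Definition bicommutes x q :=
  forall w, cmul w x = cmul x w -> cmul w q = cmul q w.

Definition ihalf m : R[i] := 'i%R * half ^+ m.

Lemma ihalf_neq0 m : ihalf m != 0.
Proof. by rewrite mulf_neq0 ?neq0Ci // gt_eqF // halfX_gt0. Qed.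

Lemma conj_ihalf m : (ihalf m)^*%R = - ihalf m.
Proof.
by rewrite /ihalf rmorphM /= conjCi rmorphXn /= fmorphV rmorph_nat mulNr.
Qed.

Lemma normr_ihalf m : `|ihalf m| = half ^+ m.
Proof. by rewrite normrM normCi mul1r ger0_norm // halfX_ge0. Qed.

(** Here q_m is x / (x + i 2^-m), so that q_{m+1} = 2 q_m / (1 + q_m). The division is a fixed point
    problem, solvable because 1 - q_m is a contraction. *)
Lemma cayley_sequence x : cstar x = x -> `|x| <= half ->
  exists q : nat -> A, (forall m, x = cmul x (q m) + ihalf m *: q m) /\
    (forall m, bicommutes x (q m)) /\
    (forall m, q m.+1 = q m + q m - cmul (q m) (q m.+1)).
Proof.
move=> xsa x2.
pose P m q := x = cmul x q + ihalf m *: q /\ bicommutes x q.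
have [q0 P0] : exists q0, P 0%N q0.
  (* The equation x = x q + i q reads q = - i x + i x q; multiplication by 2 i x is a contraction
     because |x| <= 1/2. *)
  have [||q [qE qc]] := @half_contraction_fixpoint
    (fun y => ('i%R *+ 2) *: cmul x y) (- ('i%R *: x)).
  - by move=> y z; rewrite cmulDr cmulrN scalerBr.
  - move=> y; rewrite normrZ normrMn normCi.
    apply: le_trans (ler_wpM2l _ (cnormM _ _)) _; first by rewrite ler0n.
    rewrite mulrA -[leRHS]mul1r ler_wpM2r //.
    by rewrite (le_trans (ler_wpM2l _ x2)) ?ler0n // mulfV ?pnatr_eq0.
  exists q; split=> [|w wx]; last first.
    apply: qc => [|y wy].
      by rewrite cmulrN cmulNr -cscalerAr -cscalerAl wx.
    by rewrite -cscalerAr -cscalerAl cmulA wx -!cmulA wy.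
  have {}qE : q = 'i%R *: (cmul x q - x).
    rewrite {1}qE.
    by rewrite scalerA mulr2n mulrDr -mulrDl -half_split mul1r; lin_ring.
  rewrite {2}qE /ihalf expr0 mulr1 scalerA -expr2 sqrCi scaleN1r.
  lin_ring.
(* The existential stands outside the implication so that [choice] yields a total function; 0 is a
   dummy value. *)
have step m q : exists q', P m q -> P m.+1 q' /\ q' = q + q - cmul q q'.
  have [[xq xqc]|] := pselect (P m q); last by exists 0.
  have [||q' [q'E q'c]] := @half_contraction_fixpoint
    (fun y => y - cmul q y) q.
  - by move=> y z; rewrite cmulDr cmulrN; lin_ring.
  - move=> y; exact: (cayley_compl_norm xsa (ihalf_neq0 m) (conj_ihalf m) xq).
  have {}q'E : q' = q + q - cmul q q'.
    have : q' + q' = q + q + (q' - cmul q q').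
      rewrite {1 2}q'E addrACA; congr (_ + _).
      by rewrite -scalerDl -half_split scale1r.
    by move=> h; apply: (addrI q'); rewrite h; lin_ring.
  exists q' => _; split=> //; split=> [|w wx]; last first.
    apply: q'c; first exact: xqc.
    by move=> y wy; rewrite cmulDr cmulDl cmulNr cmulrN cmulA xqc // -!cmulA wy.
  have xxq' : x + x = (cmul x q' + ihalf m.+1 *: q')
      + (cmul x q' + ihalf m.+1 *: q').
    have h1 : cmul x q = x - ihalf m *: q by rewrite {2}xq addrK.
    have h2 : cmul q q' = q + q - q' by rewrite {2}q'E; lin_ring.
    have h3 : cmul x q' = x + x - cmul x q' - ihalf m *: q'.
      rewrite {1}q'E !cmulDr cmulrN cmulA h1 cmulDl cmulNr -cscalerAl h2.
      lin_ring.
    rewrite addrACA -scalerDl; have -> : ihalf m.+1 + ihalf m.+1 = ihalf m.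
      by rewrite /ihalf -mulrDr -halfX_split.
    by rewrite {1}h3; lin_ring.
  by rewrite {1}(half_scale_sum xxq') scalerDr -scalerDl -half_split scale1r.
have {step} [f fP] := choice (fun mq => step mq.1 mq.2).
pose q := fix q m := if m is k.+1 then f (k, q k) else q0.
have qP m : P m (q m).
  by elim: m => [//|m IHm]; exact: (fP (m, q m) IHm).1.
exists q; split=> [m|]; first exact: (qP m).1.
by split=> m; [exact: (qP m).2 | exact: (fP (m, q m) (qP m)).2].
Qed.

End CStar.

(** * Power factorization *)

Section PowerFactorization.
Context {R : realType} {A : cstarAlgType R}.
Implicit Types (x y z w p : A) (c : R[i]).
Local Notation half := (2^-1 : R[i]).

(* [q m] stands for x / (x + i 2^-m). *)
Definition cutoffs x (q : nat -> A) :=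
  [/\ forall j m, cmul (q j) (q m) = cmul (q m) (q j),
      forall m, q m.+1 = q m + q m - cmul (q m) (q m.+1),
      forall m y, `|cmul (q m) y| <= `|y| /\ `|y - cmul (q m) y| <= `|y|,
      forall m, `|x - cmul (q m) x| <= half ^+ m
    & forall j m, half ^+ j * `|q j - cmul (q j) (q m)| <= half ^+ m].

Lemma cutoffs_exist x : cstar x = x -> `|x| <= half ->
  exists q, cutoffs x q.
Proof.
move=> xsa x2; have [q [xq [qx qS]]] := cayley_sequence xsa x2.
exists q.
have cN m y : `|ihalf m *: y| = half ^+ m * `|y| by rewrite normrZ normr_ihalf.
have xqC m : cmul x (q m) = cmul (q m) x by rewrite qx.
have qC j m : cmul (q j) (q m) = cmul (q m) (q j) by apply: qx; rewrite xqC.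
have qN m y := cayley_lmul_norm xsa (ihalf_neq0 m) (conj_ihalf m) (xq m) y.
have qN' m y := cayley_compl_norm xsa (ihalf_neq0 m) (conj_ihalf m) (xq m) y.
have q1 m : `|q m| <= 1 by exact: lmul_contraction_norm.
have xB m : x - cmul (q m) x = ihalf m *: q m.
  by rewrite -xqC {1}(xq m) /ihalf; lin_ring.
split=> // m; first by rewrite xB cN ler_piMr // halfX_ge0.
move=> k; rewrite -(cN m).
(* Both sides equal (1 - q_m) x (1 - q_k), which is symmetric in m and k because everything
   commutes. *)
have -> : ihalf m *: (q m - cmul (q m) (q k))
  = ihalf k *: (q k - cmul (q m) (q k)).
  have e j l : ihalf j *: (q j - cmul (q j) (q l))
     = x - cmul (q j) x - (cmul x (q l) - cmul (cmul (q j) x) (q l)).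
    rewrite scalerBr cscalerAl -xB; nc_ring.
  rewrite [in RHS](qC m k) !e -!(xqC k) -!(xqC m).
  rewrite -[cmul (cmul x (q m)) (q k)]cmulA (qC m) cmulA.
  lin_ring.
rewrite cN ler_piMr ?halfX_ge0 //.
by rewrite (le_trans (qN' _ _)).
Qed.

Lemma power2_le (a b c d : nat) : (a + d <= c + b)%N ->
  2 ^+ a * half ^+ b <= 2 ^+ c * half ^+ d.
Proof.
move=> h; rewrite !exprVn ler_pdivrMr ?exprn_gt0 ?ltr0n //.
rewrite mulrAC ler_pdivlMr ?exprn_gt0 ?ltr0n // -!exprD.
by rewrite ler_weXn2l // ler1n.
Qed.

Lemma iter_comp_comm (T : Type) (f g : T -> T) n (t : T) :
  (forall s, f (g s) = g (f s)) ->
  iter n (f \o g) t = iter n g (iter n f t).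
Proof.
move=> fg; have fgn k s : f (iter k g s) = iter k g (f s).
  by elim: k => //= k IHk; rewrite fg IHk.
by elim: n => //= n ->; rewrite -fgn fg.
Qed.

(** * Products of Cayley fractions and their inverses *)

Section Products.
Variables (x : A) (q : nat -> A).
Hypothesis xq : cutoffs x q.

Let Q k := q (k * k)%N.
Let Q' k := q (k * k).+1.
Let v k y := y + (y - cmul (Q' k) y).

(* With t = 2^-(j^2), the factor 1/2 + Q_j / 2 stands for the fraction
   (x + i t / 2) / (x + i t), with inverse [v j]. In the unitization,
   2^-k + [pprod k] is the product of these factors for j < k, and [pinv k] is
   the multiplication by its inverse. The products converge because the
   exponents j^2 grow faster than linearly. *)
Fixpoint pprod k : A := if k is j.+1 then
  half ^+ j.+1 *: Q j + half *: (pprod j + cmul (pprod j) (Q j)) else 0.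

Fixpoint pinv k y : A := if k is j.+1 then v j (pinv j y) else y.

Let q1 m : `|q m| <= 1.
Proof. by apply: lmul_contraction_norm => y; case: xq => _ _ /(_ m y)[]. Qed.

(** Each factor is the mean of 1 and a contraction, and the full product has weight 2^-k on the
    unit; the rest of the weight bounds the norm. *)
Lemma pprod_norm k : `|pprod k| <= 1 - half ^+ k.
Proof.
elim: k => [|k IHk]; first by rewrite normr0 expr0 subrr.
rewrite /=; apply: le_trans (ler_normD _ _) _.
rewrite !normrZ (ger0_norm half_ge0) (ger0_norm (halfX_ge0 _)).
apply: (@le_trans _ _ (half ^+ k.+1 + (1 - half ^+ k))).
  apply: lerD; first by rewrite ler_piMr ?halfX_ge0 ?q1.
  rewrite mulrC ler_pdivrMr ?ltr0n // mulr_natr mulr2n.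
  apply: le_trans (ler_normD _ _) _; apply: lerD => //.
  exact: le_trans (cnormMl_le1 _ (q1 _)) IHk.
rewrite (halfX_split k).
by rewrite le_eqVlt; apply/orP; left; apply/eqP; ring.
Qed.

Lemma pprod_norm1 k : `|pprod k| <= 1.
Proof.
by rewrite (le_trans (pprod_norm k)) // gerDl oppr_le0 halfX_ge0.
Qed.

(** Only Q_j with j < k occur, and the smallest parameter, 2^-((k-1)^2), dominates. The weights
    2^-(k+1), 1/2 and (1 - 2^-k)/2 of the induction step sum to 1. At k = 0 the element is 0, so the
    truncated predecessor is harmless. *)
Lemma pprod_compl k m :
  half ^+ (k.-1 * k.-1) * `|pprod k - cmul (pprod k) (q m)| <= half ^+ m.
Proof.
elim: k => [|k IHk]; first by rewrite cmul0r subrr normr0 mulr0 halfX_ge0.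
set s := half ^+ _; set a := pprod k in IHk *.
have s0 : 0 <= s by exact: halfX_ge0.
have sq : s * `|Q k - cmul (Q k) (q m)| <= half ^+ m.
  by case: xq => _ _ _ _; exact.
have -> : pprod k.+1 - cmul (pprod k.+1) (q m) =
    half ^+ k.+1 *: (Q k - cmul (Q k) (q m))
    + half *: ((a - cmul a (q m)) + cmul a (Q k - cmul (Q k) (q m))).
  by rewrite /= -/a !cmulE -!cscalerAl !cmulE; lin_ring.
have -> z : s * `|z| = `|s *: z| by rewrite normrZ (ger0_norm s0).
rewrite scalerDr !scalerA.
apply: le_trans (ler_normD _ _) _.
apply: (@le_trans _ _ (half ^+ k.+1 * half ^+ m
   + half * (half ^+ m + (1 - half ^+ k) * half ^+ m))).
  apply: lerD.
    rewrite mulrC -scalerA normrZ (ger0_norm (halfX_ge0 _)).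
    by rewrite normrZ (ger0_norm s0) ler_wpM2l ?halfX_ge0.
  rewrite mulrC -scalerA normrZ (ger0_norm half_ge0) ler_wpM2l ?half_ge0 //.
  rewrite scalerDr; apply: le_trans (ler_normD _ _) _; apply: lerD.
    rewrite normrZ (ger0_norm s0); apply: le_trans IHk.
    by rewrite ler_wpM2r // halfX_le // leq_mul // leq_pred.
  rewrite cscalerAr; apply: le_trans (cnormM _ _) _.
  by rewrite normrZ (ger0_norm s0) ler_pM // ?mulr_ge0 // pprod_norm.
rewrite le_eqVlt; apply/orP; left; apply/eqP.
have -> : half ^+ k.+1 * half ^+ m
    + half * (half ^+ m + (1 - half ^+ k) * half ^+ m)
  = (half + half) * half ^+ m by rewrite exprS; ring.
by rewrite -half_split mul1r.
Qed.

(** Apart from 2^-(k+1) Q_k, the increment is half of a_k (1 - Q_k) up to sign, where a_k is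
    [pprod k]. This is small since k^2 - (k-1)^2 >= k for k > 0. *)
Lemma pprod_cauchy k : `|pprod k.+1 - pprod k| <= 1 * half ^+ k.
Proof.
have -> : pprod k.+1 - pprod k =
    half ^+ k.+1 *: Q k - half *: (pprod k - cmul (pprod k) (Q k)).
  rewrite /= [X in _ - X](_ : _ = half *: pprod k + half *: pprod k).
    by lin_ring.
  by rewrite -scalerDl -half_split scale1r.
rewrite mul1r; apply: le_trans (ler_normB _ _) _.
rewrite !normrZ (ger0_norm half_ge0) (ger0_norm (halfX_ge0 _)).
rewrite [leRHS]halfX_split; apply: lerD.
  by rewrite ler_piMr ?halfX_ge0 ?q1.
rewrite exprS ler_wpM2l ?half_ge0 //.
case: k => [|k]; first by rewrite cmul0r subrr normr0 halfX_ge0.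
have := pprod_compl k.+1 (k.+1 * k.+1)%N; rewrite [k.+1.-1]/= -/(Q k.+1).
have -> : (k.+1 * k.+1)%N = (k * k + k.*2.+1)%N by lia.
rewrite exprD ler_pM2l ?halfX_gt0 // => /le_trans; apply.
by rewrite halfX_le //; lia.
Qed.

Lemma pprod_pinv k y : half ^+ k *: pinv k y + cmul (pprod k) (pinv k y) = y.
Proof.
elim: k => [|k IHk]; first by rewrite expr0 scale1r cmul0r addr0.
rewrite /=; set z := pinv k y; set a := pprod k; set w := v k z.
(* The recursion of the cutoffs says that (1 + Q_k) (2 - Q'_k) = 2. *)
have wz : w + cmul (Q k) w = z + z.
  have Q'E : Q' k = Q k + Q k - cmul (Q k) (Q' k).
    by case: xq => _ + _ _ _; exact.
  by rewrite /w /v {1}Q'E; nc_ring.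
transitivity (half *: (half ^+ k *: (w + cmul (Q k) w)
                       + cmul a (w + cmul (Q k) w))).
  by rewrite exprS !cmulE -!cscalerAl !cmulE; lin_ring.
rewrite wz cmulDr -[RHS]IHk -/z -/a.
set t := RHS; rewrite [_ *: (z + z) + _](_ : _ = t + t).
  by rewrite scalerDr -scalerDl -half_split scale1r.
by rewrite /t; lin_ring.
Qed.

Lemma pinv_additive k : {morph pinv k : y z / y - z}.
Proof.
elim: k => [//|k IHk] y z /=; rewrite IHk /v cmulDr cmulrN.
by set u := pinv k y; set w := pinv k z; lin_ring.
Qed.

Lemma pinv_norm k y : `|pinv k y| <= 2 ^+ k * `|y|.
Proof.
elim: k => [|k IHk]; first by rewrite expr0 mul1r.
rewrite /= exprS -mulrA; apply: le_trans (ler_normD _ _) _.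
rewrite mulr_natl mulr2n; apply: lerD => //; apply: le_trans IHk.
by case: xq => _ _ /(_ (k * k).+1 (pinv k y))[].
Qed.

Lemma pinv_comm j k y : v j (pinv k y) = pinv k (v j y).
Proof.
elim: k => [//|k IHk] /=; rewrite -IHk /v.
set z := pinv k y; have h : cmul (Q' j) (Q' k) = cmul (Q' k) (Q' j).
  by case: xq => + _ _ _ _; exact.
by rewrite !cmulDr !cmulrN !cmulA h; lin_ring.
Qed.

Lemma iter_pinv_norm n k y :
  `|iter n (pinv k) y| <= 2 ^+ (n * k) * `|y|.
Proof.
elim: n => [|n IHn]; first by rewrite mul1r.
rewrite /= mulSn exprD -mulrA; apply: le_trans (pinv_norm _ _) _.
by rewrite ler_wpM2l // exprn_ge0.
Qed.

Lemma iter_pinvB n k : {morph iter n (pinv k) : y z / y - z}.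
Proof. by elim: n => [//|n IHn] y z; rewrite /= IHn pinv_additive. Qed.

(** [v k] is multiplication by 1 + (1 - Q'_k), and 1 - Q'_k nearly annihilates [x]. *)
Lemma iter_factor n k :
  `|iter n (v k) x - x| <= 2 ^+ n * half ^+ (k * k).+1.
Proof.
have [_ _ qN /(_ (k * k).+1) xN _] := xq.
set r := half ^+ _ in xN *.
(* An error e becomes at most 2 e + r, so that e + r merely doubles. *)
suff : `|iter n (v k) x - x| + r <= 2 ^+ n * r.
  by apply: le_trans; rewrite lerDl halfX_ge0.
elim: n => [|n IHn]; first by rewrite subrr normr0 add0r mul1r.
rewrite exprS -mulrA mulr_natl mulr2n.
apply: le_trans (lerD IHn IHn); rewrite iterS.
set z := iter n _ x; rewrite [leRHS](_ : _ = `|z - x| + (`|z - x| + r) + r).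
  rewrite lerD2r.
  have -> : v k z - x =
      (z - x) + ((z - x - cmul (Q' k) (z - x)) + (x - cmul (Q' k) x)).
    by rewrite /v cmulDr cmulrN; lin_ring.
  apply: le_trans (ler_normD _ _) _; apply: lerD => //.
  apply: le_trans (ler_normD _ _) _; apply: lerD => //.
  exact: (qN _ _).2.
by ring.
Qed.

(** The growth 2^(n k) of the inverses is beaten by the factor 2^-(k^2 + 1), since (n+1) k <=
    (n+1)^2 + k^2. *)
Lemma iter_pinv_cauchy n k :
  `|iter n (pinv k.+1) x - iter n (pinv k) x|
    <= 2 ^+ (n + n.+1 * n.+1) * half ^+ k.
Proof.
rewrite (@iter_comp_comm _ (v k) (pinv k)); last exact: pinv_comm.
rewrite -iter_pinvB; apply: le_trans (iter_pinv_norm _ _ _) _.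
apply: le_trans (ler_wpM2l _ (iter_factor n k)) _; first by rewrite exprn_ge0.
rewrite mulrA -exprD; apply: power2_le.
nia.
Qed.

End Products.

(** [b] is the limit of [pprod], and [c n], the limit of the n-fold [pinv] applied to [x], stands
    for b^-n x. The weight 2^-k on the unit vanishes in the limit. *)
Lemma power_factorization x : cstar x = x -> `|x| <= half ->
  exists b (c : nat -> A), c 0%N = x /\ forall n, cmul b (c n.+1) = c n.
Proof.
move=> xsa x2; have [q xq] := cutoffs_exist xsa x2.
have [b [d bd]] := geometric_cvg (pprod_cauchy xq).
have [c cP] := choice (fun n => geometric_cvg (iter_pinv_cauchy xq n)).
have geo_le (y : A) k (e : R[i]) : `|y| <= e * half ^+ k -> 0 <= e.
  by move/(le_trans (normr_ge0 y)); rewrite pmulr_lge0 ?halfX_gt0.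
have d0 := geo_le _ _ _ (bd 0%N).
exists b, c; split=> [|n].
  have [e ce] := cP 0%N.
  apply/eqP; rewrite -subr_eq0; apply/eqP.
  by apply: (@le_geometric_eq0 R A _ e) => k; rewrite distrC; exact: ce.
have [e ce] := cP n; have [f cf] := cP n.+1.
have f0 := geo_le _ _ _ (cf 0%N).
apply/eqP; rewrite -subr_eq0; apply/eqP.
apply: (@le_geometric_eq0 R A _ (d * `|c n.+1| + f + (`|c n.+1| + f) + e)) => k.
pose a := pprod q k; pose u := iter n (pinv q k) x.
pose w := iter n.+1 (pinv q k) x.
have uE : half ^+ k *: w + cmul a w = u by exact: (pprod_pinv xq).
(* The four errors come from replacing b by a, c_{n+1} by w, dropping the scalar part, and replacing
   u by c_n. *)
have -> : cmul b (c n.+1) - c n = - cmul (a - b) (c n.+1)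
    - cmul a (w - c n.+1) - half ^+ k *: w + (u - c n).
  by rewrite -{1}uE; nc_ring.
have fk : `|w - c n.+1| <= f * half ^+ k by exact: cf.
rewrite 3!mulrDl; apply: le_trans (ler_normD _ _) _.
apply: lerD; last exact: ce.
apply: le_trans (ler_normB _ _) _; apply: lerD.
  apply: le_trans (ler_normB _ _) _; apply: lerD.
    rewrite normrN; apply: le_trans (cnormM _ _) _.
    by rewrite mulrAC ler_wpM2r // bd.
  apply: le_trans (cnormM _ _) _; apply: le_trans fk.
  by rewrite ler_piMl // (pprod_norm1 xq).
rewrite normrZ (ger0_norm (halfX_ge0 _)) mulrC ler_wpM2r ?halfX_ge0 //.
rewrite -[w](subrKC (c n.+1)); apply: le_trans (ler_normD _ _) _.
by rewrite lerD // (le_trans fk) // ler_piMr // halfX_le1.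
Qed.

End PowerFactorization.

(** * Subspaces and prime ideals *)

Section Subspaces.
Context {R : realType} {A : cstarAlgType R}.
Implicit Types (x y z a b : A) (X Y L M : set A).

Section Closure.
Variables (L : set A) (hL : linear_subspace L).

Lemma subspace0 : L 0. Proof. by case: hL. Qed.

Lemma subspaceD x y : L x -> L y -> L (x + y).
Proof. by move=> Lx Ly; rewrite -[x]scale1r; apply: hL.2. Qed.

Lemma subspaceZ c x : L x -> L (c *: x).
Proof.
by move=> Lx; rewrite -[_ *: _]addr0; apply: hL.2 => //; exact: hL.1.
Qed.

Lemma subspaceN x : L x -> L (- x).
Proof. by move=> Lx; rewrite -scaleN1r; exact: subspaceZ. Qed.

Lemma subspaceB x y : L x -> L y -> L (x - y).
Proof. by move=> Lx Ly; apply: subspaceD => //; exact: subspaceN. Qed.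

Lemma lin_span_min X : X `<=` L -> lin_span X `<=` L.
Proof.
move=> XL _ [n [c [x [Xx ->]]]].
by apply: (big_ind L subspace0 subspaceD) => i _; apply/subspaceZ/XL.
Qed.

End Closure.

Lemma sub_lin_span X : X `<=` lin_span X.
Proof.
move=> x Xx; exists 1%N, (fun=> 1), (fun=> x); split=> //.
by rewrite big_ord1 scale1r.
Qed.

Lemma lin_span_subspace X : linear_subspace (lin_span X).
Proof.
split.
  by exists 0%N, (fun=> 0), (fun=> 0); split=> [[]//|]; rewrite big_ord0.
move=> e _ _ [n [c [x [Xx ->]]]] [m [d [y [Yy ->]]]].
exists (n + m)%N,
  (fun i => match fintype.split i with inl j => e * c j | inr j => d j end),
  (fun i => match fintype.split i with inl j => x j | inr j => y j end).
split=> [i|]; first by case: (fintype.split i).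
rewrite big_split_ord scaler_sumr; congr (_ + _); apply: eq_bigr => i _.
  by rewrite (unsplitK (inl i)) scalerA.
by rewrite (unsplitK (inr i)).
Qed.

Lemma sum_set_subspace X Y :
  linear_subspace X -> linear_subspace Y -> linear_subspace (sum_set X Y).
Proof.
move=> hX hY; split.
  by exists 0; [exact: hX.1 | exists 0; [exact: hY.1 | rewrite addr0]].
move=> c _ _ [x Xx [y Yy <-]] [x' Xx' [y' Yy' <-]].
exists (c *: x + x'); first exact: hX.2.
by exists (c *: y + y'); [exact: hY.2 | lin_ring].
Qed.

Lemma sum_setl X Y : linear_subspace Y -> X `<=` sum_set X Y.
Proof.
by move=> hY x Xx; exists x => //; exists 0; [exact: hY.1 | rewrite addr0].
Qed.

Lemma sum_setr X Y : linear_subspace X -> Y `<=` sum_set X Y.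
Proof.
by move=> hX y Yy; exists 0; [exact: hX.1 | exists y; rewrite ?add0r].
Qed.

Lemma sum_set_min X Y L : linear_subspace L -> X `<=` L -> Y `<=` L ->
  sum_set X Y `<=` L.
Proof.
by move=> hL XL YL _ [x Xx [y Yy <-]]; apply: subspaceD; [|apply: XL|apply: YL].
Qed.

Lemma comm_spanI X Y x y : X x -> Y y -> comm_span X Y (commutator x y).
Proof. by move=> Xx Yy; apply: sub_lin_span; exists x => //; exists y. Qed.

Lemma prod_spanI X Y x y : X x -> Y y -> prod_span X Y (cmul x y).
Proof. by move=> Xx Yy; apply: sub_lin_span; exists x => //; exists y. Qed.

Lemma comm_span_min X Y L : linear_subspace L ->
  (forall x y, X x -> Y y -> L (commutator x y)) -> comm_span X Y `<=` L.
Proof.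
by move=> hL h; apply: lin_span_min => // _ [x Xx [y Yy <-]]; exact: h.
Qed.

Lemma prod_span_min X Y L : linear_subspace L ->
  (forall x y, X x -> Y y -> L (cmul x y)) -> prod_span X Y `<=` L.
Proof.
by move=> hL h; apply: lin_span_min => // _ [x Xx [y Yy <-]]; exact: h.
Qed.

(** Together with [lin_span_min], this reduces claims about the image of a span under a linear map
    to its generators. *)
Lemma preimage_subspace (f : A -> A) L : linear_subspace L ->
  (forall c x y, f (c *: x + y) = c *: f x + f y) ->
  linear_subspace [set x | L (f x)].
Proof.
move=> hL fP; split=> /=.
  have := fP 0 0 0; rewrite scale0r !addr0 => -> //.
  by rewrite scale0r add0r; have := fP (-1) 0 0; rewrite scaleN1r oppr0 addr0
    scaleN1r addNr => ->; exact: hL.1.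
by move=> c x y Lx Ly; rewrite fP; exact: hL.2.
Qed.

Lemma preimage_lmul_subspace a L : linear_subspace L ->
  linear_subspace [set x | L (cmul a x)].
Proof.
by move=> hL; apply: preimage_subspace => // c x y; rewrite cmulDr cscalerAr.
Qed.

Lemma preimage_rmul_subspace a L : linear_subspace L ->
  linear_subspace [set x | L (cmul x a)].
Proof.
move=> hL; apply: (@preimage_subspace (fun x => cmul x a)) => // c x y.
by rewrite cmulDl cscalerAl.
Qed.

Lemma preimage_comm_subspace a L : linear_subspace L ->
  linear_subspace [set x | L (commutator a x)].
Proof.
move=> hL; apply: preimage_subspace => // c x y.
by rewrite /commutator cmulDr cmulDl -cscalerAr -cscalerAl; lin_ring.
Qed.

Definition two_sided_ideal L : Prop :=
  linear_subspace L /\ forall a x, L x -> L (cmul a x) /\ L (cmul x a).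

Section AlgIdeal.
Variables (M : set A) (hM : linear_subspace M).

Let S1 := prod_span setT M.
Let S2 := prod_span M setT.
Let S3 := prod_span (prod_span setT M) setT.

Let hS1 : linear_subspace S1. Proof. exact: lin_span_subspace. Qed.
Let hS2 : linear_subspace S2. Proof. exact: lin_span_subspace. Qed.
Let hS3 : linear_subspace S3. Proof. exact: lin_span_subspace. Qed.

Let hMS1 : linear_subspace (sum_set M S1).
Proof. exact: sum_set_subspace. Qed.

Let hMS12 : linear_subspace (sum_set (sum_set M S1) S2).
Proof. exact: sum_set_subspace. Qed.

Let alg_ideal_sub L : linear_subspace L -> M `<=` L -> S1 `<=` L ->
  S2 `<=` L -> S3 `<=` L -> alg_ideal M `<=` L.
Proof. by move=> hL ML S1L S2L S3L; do !apply: sum_set_min. Qed.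

Lemma alg_ideal_min L : two_sided_ideal L -> M `<=` L -> alg_ideal M `<=` L.
Proof.
move=> [hL idL] ML.
have S1L : S1 `<=` L.
  by apply: prod_span_min => // a x _ Mx; exact: (idL a x (ML x Mx)).1.
apply: alg_ideal_sub => //.
  by apply: prod_span_min => // x a Mx _; exact: (idL a x (ML x Mx)).2.
by apply: prod_span_min => // x a Sx _; exact: (idL a x (S1L x Sx)).2.
Qed.

Lemma sub_alg_ideal : M `<=` alg_ideal M.
Proof.
by move=> x Mx; exact: (sum_setl hS3 (sum_setl hS2 (sum_setl hS1 Mx))).
Qed.

Lemma alg_ideal_two_sided : two_sided_ideal (alg_ideal M).
Proof.
have hI : linear_subspace (alg_ideal M) by exact: sum_set_subspace.
have S1I : S1 `<=` alg_ideal M.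
  by move=> x Sx; exact: (sum_setl hS3 (sum_setl hS2 (sum_setr hM Sx))).
have S2I : S2 `<=` alg_ideal M.
  by move=> x Sx; exact: (sum_setl hS3 (sum_setr hMS1 Sx)).
have S3I : S3 `<=` alg_ideal M by move=> x Sx; exact: (sum_setr hMS12 Sx).
split=> // a x Ix; split.
- have h := preimage_lmul_subspace a hI.
  have S1a : S1 `<=` [set x | S1 (cmul a x)].
    apply: prod_span_min; first exact: preimage_lmul_subspace.
    by move=> b m _ Mm /=; rewrite cmulA; exact: prod_spanI.
  move: x Ix; apply: alg_ideal_sub => //=.
  + by move=> m Mm /=; apply/S1I/prod_spanI.
  + by move=> s /S1a /S1I.
  + apply: prod_span_min => // m b Mm _ /=; rewrite cmulA.
    by apply/S3I/prod_spanI => //; exact: prod_spanI.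
  + apply: prod_span_min => // s b Ss _ /=; rewrite cmulA.
    by apply/S3I/prod_spanI => //; exact: S1a.
- have h := preimage_rmul_subspace a hI.
  move: x Ix; apply: alg_ideal_sub => //=.
  + by move=> m Mm /=; apply/S2I/prod_spanI.
  + by move=> s Ss /=; apply/S3I/prod_spanI.
  + apply: prod_span_min => // m b Mm _ /=; rewrite -cmulA.
    exact/S2I/prod_spanI.
  + apply: prod_span_min => // s b Ss _ /=; rewrite -cmulA.
    exact/S3I/prod_spanI.
Qed.

End AlgIdeal.

(** * Prime ideals above a proper ideal *)

Definition prime_ideal L : Prop :=
  [/\ two_sided_ideal L, L <> setT &
      forall x y, (forall a, L (cmul (cmul x a) y)) -> L x \/ L y].

Lemma cmul_iter n b x y :
  cmul (iter n (cmul b) x) y = iter n (cmul b) (cmul x y).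
Proof. by elim: n => //= n <-; rewrite cmulA. Qed.

(** The selfadjoint elements span A, so one of them, x, is outside [J]. After scaling, x = b^(n+1)
    c_{n+1} for all n, hence no power of b is in [J]; [iter n (cmul b) b] is b^(n+1). *)
Lemma power_avoiding_element J : two_sided_ideal J -> J <> setT ->
  exists b, forall n, ~ J (iter n (cmul b) b).
Proof.
move=> [hJ idJ] JT.
have [x [xsa Jx]] : exists x, cstar x = x /\ ~ J x.
  apply: contrapT => h; apply: JT; rewrite -subTset => a _.
  have {}h x : cstar x = x -> J x.
    by move=> xsa; apply: contrapT => Jx; apply: h; exists x.
  have h1 : J (a + cstar a) by apply: h; rewrite cstarD cstarK addrC.
  have h2 : J ('i%R *: (a - cstar a)).
    by apply: h; rewrite cstarZ conjCi cstarD cstarN cstarK; lin_ring.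
  rewrite (_ : a = 2^-1 *: ((a + cstar a) - 'i%R *: ('i%R *: (a - cstar a)))).
    by apply: subspaceZ => //; apply: subspaceB => //; exact: subspaceZ.
  apply: half_scale_sum; rewrite scalerA -expr2 sqrCi; lin_ring.
have x0 : x != 0 by apply: contra_notN Jx => /eqP ->; exact: hJ.1.
pose s := (`|x| * 2)^-1.
have s0 : 0 < s by rewrite invr_gt0 mulr_gt0 ?normr_gt0.
have [||b [c [c0 bc]]] := @power_factorization R A (s *: x).
- by rewrite cstarZ xsa conj_Creal // ger0_real // ltW.
- by rewrite normrZ gtr0_norm // /s invfM mulrAC mulVf ?mul1r // normr_eq0.
exists b => n Jb; apply: Jx.
rewrite -[x](scalerK (lt0r_neq0 s0)); apply: subspaceZ => //; rewrite -c0.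
have -> : c 0%N = cmul (iter n (cmul b) b) (c n.+1).
  rewrite cmul_iter bc; elim: n {Jb} => //= n IHn.
  by rewrite {1}IHn -iterS iterSr bc.
exact: (idJ _ _ Jb).2.
Qed.

(** An ideal maximal among those that contain [J] and avoid the powers of b is prime. *)
Lemma prime_ideal_above J : two_sided_ideal J -> J <> setT ->
  exists2 P, prime_ideal P & J `<=` P.
Proof.
move=> idJ /(power_avoiding_element idJ)[b Jb].
pose good I := two_sided_ideal I /\ forall n, ~ I (iter n (cmul b) b).
(* Zorn's lemma is applied to sets whose union with [J] is good, so that the empty chain is covered
   as well. *)
have [F FP totF|I [gI maxI]] := @Zorn_bigcup A (fun I => good (J `|` I)).
  set U := J `|` _.
  have dir x y : U x -> U y -> exists G, [/\ good G, G `<=` U, G x & G y].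
    have JU : J `<=` U by exact: subsetUl.
    have FU X : F X -> J `|` X `<=` U.
      by move=> FX z [Jz|Xz]; [left|right; exists X].
    move=> [Jx|[X FX Xx]] [Jy|[Y FY Yy]].
    - by exists J.
    - by exists (J `|` Y); split; [exact: FP|exact: FU|left|right].
    - by exists (J `|` X); split; [exact: FP|exact: FU|right|left].
    - have [XY|YX] := totF _ _ FX FY.
        exists (J `|` Y).
        by split; [exact: FP|exact: FU|right; exact: XY|right].
      exists (J `|` X).
      by split; [exact: FP|exact: FU|right|right; exact: YX].
  split; last first.
    by move=> n Ub; have [G [gG _ Gb _]] := dir _ _ Ub Ub; exact: gG.2 Gb.
  split; [split|].
  - by left; exact: idJ.1.1.
  - move=> c x y Ux Uy; have [G [gG GU Gx Gy]] := dir _ _ Ux Uy.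
    by apply: GU; exact: gG.1.1.2.
  - move=> a x Ux; have [G [gG GU Gx _]] := dir _ _ Ux Ux.
    by split; apply: GU; have [] := gG.1.2 a x Gx.
exists (J `|` I); last exact: subsetUl.
have [idP Pb] := gI; set P := J `|` I in idP Pb *.
have maxP Q : two_sided_ideal Q -> P `<=` Q -> (exists2 x, Q x & ~ P x) ->
    exists n, Q (iter n (cmul b) b).
  move=> idQ PQ [x Qx Px]; apply: contrapT => h.
  apply: (maxI Q).
    split; first by apply: subset_trans PQ; exact: subsetUr.
    by move=> QI; apply: Px; right; exact: QI.
  rewrite setUidr; last by apply: subset_trans PQ; exact: subsetUl.
  by split=> // n Qb; apply: h; exists n.
split=> // [PT|x y xy]; first by apply: (Pb 0%N); rewrite PT.
have [Px|Px] := pselect (P x); first by left.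
have [Py|Py] := pselect (P y); [by right|exfalso].
(* The ideal of all v with v A y in P contains P and x, hence b^(n+1) for some n. *)
have [|||n bn] := maxP [set v | forall a, P (cmul (cmul v a) y)].
- split; [split=> [a|c u v Pu Pv a]|move=> a v Pv] => /=.
  + by rewrite !cmul0r; exact: idP.1.1.
  + by rewrite !cmulDl -!cscalerAl; exact: idP.1.2.
  + split=> d; first by rewrite -!cmulA (cmulA v); exact: (idP.2 _ _ (Pv d)).1.
    by rewrite -(cmulA v); exact: Pv.
- by move=> v Pv a; apply: (idP.2 _ _ _).2; exact: (idP.2 _ _ Pv).2.
- by exists x.
(* Now the ideal of all v with b^(n+1) A v in P contains P and y, hence b^(m+1) for some m. *)
have [|||m bm] := maxP
    [set v | forall a, P (cmul (cmul (iter n (cmul b) b) a) v)].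
- split; [split=> [a|c u v Pu Pv a]|move=> a v Pv] => /=.
  + by rewrite cmulr0; exact: idP.1.1.
  + by rewrite !cmulDr -!cscalerAr; exact: idP.1.2.
  + split=> d; last by rewrite cmulA; exact: (idP.2 _ _ (Pv d)).2.
    by rewrite cmulA -(cmulA _ d); exact: Pv.
- by move=> v Pv a; exact: (idP.2 _ _ Pv).1.
- by exists y.
(* With b as the middle factor, b^(n+1) b b^(m+1) = b^(n+m+3) lies in P. *)
apply: (Pb (n.+2 + m)%N); rewrite iterD !iterSr.
by have := bm b; rewrite !cmul_iter -(cmulA b b).
Qed.

Lemma generates_or_prime M : linear_subspace M ->
  generates_as_ideal M \/ exists2 P, prime_ideal P & M `<=` P.
Proof.
move=> hM; have [|nM] := pselect (generates_as_ideal M); [by left|right].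
have [P pP MP] := prime_ideal_above (alg_ideal_two_sided hM) nM.
by exists P => // x /sub_alg_ideal/MP.
Qed.

Lemma generates_not_prime M P : generates_as_ideal M -> prime_ideal P ->
  ~ M `<=` P.
Proof.
move=> gM [idP PT _] MP; apply: PT; rewrite -subTset -gM.
exact: alg_ideal_min.
Qed.

End Subspaces.

(** * Lie ideals *)

Section LieIdeals.
Context {R : realType} {A : cstarAlgType R}.
Implicit Types (x y z a b c : A) (K L M P : set A).

Lemma commutatorC x y : commutator x y = - commutator y x.
Proof. by nc_ring. Qed.

(** This identity puts [A, L L] inside [A, L]. *)
Lemma commutator_cyclic a x y :
  commutator a (cmul x y) = commutator (cmul a x) y + commutator (cmul y a) x.
Proof. by nc_ring. Qed.

Lemma commutator_jacobi a x y : commutator a (commutator x y) =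
  commutator (commutator a x) y + commutator x (commutator a y).
Proof. by nc_ring. Qed.

Lemma comm_span_subspace K L : linear_subspace (comm_span K L).
Proof. exact: lin_span_subspace. Qed.

Lemma comm_spanS K K' L L' :
  K `<=` K' -> L `<=` L' -> comm_span K L `<=` comm_span K' L'.
Proof.
move=> KK' LL'; apply: comm_span_min; first exact: comm_span_subspace.
by move=> x y /KK' Kx /LL' Ly; exact: comm_spanI.
Qed.

Lemma lie_ideal_comml L a x : lie_ideal L -> L x -> L (commutator a x).
Proof. by move=> [_ hL] Lx; apply: hL; exact: comm_spanI. Qed.

Lemma lie_ideal_commr L x a : lie_ideal L -> L x -> L (commutator x a).
Proof.
move=> hL Lx; rewrite commutatorC; apply: (subspaceN hL.1).
exact: lie_ideal_comml.
Qed.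

Lemma comm_span_lie_ideal K L :
  lie_ideal K -> lie_ideal L -> lie_ideal (comm_span K L).
Proof.
move=> hK hL; have hKL := comm_span_subspace K L.
split=> //; apply: comm_span_min => // a m _.
move: m; apply: comm_span_min; first exact: preimage_comm_subspace.
move=> x y Kx Ly /=; rewrite commutator_jacobi; apply: subspaceD => //.
  by apply: comm_spanI => //; exact: lie_ideal_comml.
by apply: comm_spanI => //; exact: lie_ideal_comml.
Qed.

(** W = L + L L contains the ideal generated by [L, L], hence is A, while [A, W] lies in [A, L] by
    [commutator_cyclic]. *)
Lemma comm_span_generating L : lie_ideal L ->
  generates_as_ideal (comm_span L L) ->
  comm_span setT setT `<=` comm_span setT L.
Proof.
move=> hL genL; pose W := sum_set L (prod_span L L).
have hLL : linear_subspace (prod_span L L) by exact: lin_span_subspace.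
have hW : linear_subspace W by apply: sum_set_subspace => //; exact: hL.1.
have hAL := comm_span_subspace setT L.
have LW : L `<=` W by exact: sum_setl.
have LLW x y : L x -> L y -> W (cmul x y).
  by move=> Lx Ly; apply: (sum_setr hL.1); exact: prod_spanI.
have commW a w : W w -> comm_span setT L (commutator a w).
  move: w; apply: sum_set_min; first exact: preimage_comm_subspace.
    by move=> x Lx; exact: comm_spanI.
  apply: prod_span_min; first exact: preimage_comm_subspace.
  move=> x y Lx Ly /=; rewrite commutator_cyclic.
  by apply: (subspaceD hAL); exact: comm_spanI.
have AWL a w : W w -> L (commutator a w) by move=> /(commW a)/hL.2.
have WrL x y a : L x -> L y -> W (cmul (commutator x y) a).
  move=> Lx Ly.
  have -> : cmul (commutator x y) a =
      commutator x (cmul y a) - cmul y (commutator x a) by nc_ring.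
  apply: subspaceB => //; first by apply: LW; exact: lie_ideal_commr.
  by apply: LLW => //; exact: lie_ideal_commr.
have MW : comm_span L L `<=` W.
  by apply: comm_span_min => // x y Lx Ly; apply: LW; exact: lie_ideal_comml.
have WlL x y b : L x -> L y -> W (cmul b (commutator x y)).
  move=> Lx Ly.
  have -> : cmul b (commutator x y) =
      commutator b (commutator x y) + cmul (commutator x y) b by nc_ring.
  apply: subspaceD => //; last exact: WrL.
  by apply: LW; apply: lie_ideal_comml => //; exact: lie_ideal_comml.
have IW : alg_ideal (comm_span L L) `<=` W.
  do 3?[apply: sum_set_min => //].
  - apply: prod_span_min => // b m _.
    move: m; apply: comm_span_min; first exact: preimage_lmul_subspace.
    by move=> x y; exact: WlL.
  - apply: prod_span_min => // m a + _.
    move: m; apply: comm_span_min; first exact: preimage_rmul_subspace.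
    by move=> x y; exact: WrL.
  - apply: prod_span_min => // s a + _.
    move: s; apply: prod_span_min; first exact: preimage_rmul_subspace.
    move=> b m _; move: m; apply: comm_span_min.
      exact: (preimage_lmul_subspace b (preimage_rmul_subspace a hW)).
    move=> x y Lx Ly /=.
    (* As [x, y] a is already in W, its commutator with b is in [A, W], hence in L. *)
    have -> : cmul (cmul b (commutator x y)) a =
      commutator b (cmul (commutator x y) a) + cmul (commutator x y) (cmul a b).
      by nc_ring.
    apply: subspaceD => //; last exact: WrL.
    by apply/LW/AWL; exact: WrL.
apply: comm_span_min => // a z _ _; apply: commW; apply: IW.
by rewrite genL.
Qed.

(** * Herstein's arguments modulo a prime ideal *)

Section ModuloPrime.
Variables (P : set A) (hP : prime_ideal P).

Definition central_mod x := forall a, P (commutator x a).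

Let hPs : linear_subspace P. Proof. by case: hP => -[]. Qed.
Let Pl a x : P x -> P (cmul a x).
Proof. by case: hP => -[_ h] _ _ Px; exact: (h a x Px).1. Qed.
Let Pr a x : P x -> P (cmul x a).
Proof. by case: hP => -[_ h] _ _ Px; exact: (h a x Px).2. Qed.
Let PD x y : P x -> P y -> P (x + y). Proof. exact: subspaceD. Qed.
Let PB x y : P x -> P y -> P (x - y). Proof. exact: subspaceB. Qed.

Lemma comm_span_centrall K L : K `<=` central_mod -> comm_span K L `<=` P.
Proof.
by move=> KP; apply: comm_span_min => // x y Kx _; exact: (KP x Kx y).
Qed.

Lemma comm_span_centralr K L : L `<=` central_mod -> comm_span K L `<=` P.
Proof.
move=> LP; apply: comm_span_min => // x y _ Ly.
by rewrite commutatorC; apply: (subspaceN hPs); exact: (LP y Ly x).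
Qed.

(** For D = [y, -] the Leibniz rule for D^2 (a b) gives 2 D(a) D(b) = 0 modulo [P]. Replacing b by c
    b yields D(a) c D(b) = 0, and primeness applies with b = a. *)
Lemma central_mod_sq y :
  (forall a, P (commutator y (commutator y a))) -> central_mod y.
Proof.
move=> yy.
have DD a b : P (cmul (commutator y a) (commutator y b)).
  have -> : cmul (commutator y a) (commutator y b) =
      2^-1 *: (commutator y (commutator y (cmul a b))
        - cmul (commutator y (commutator y a)) b
        - cmul a (commutator y (commutator y b))).
    by apply: half_scale_sum; nc_ring.
  apply: subspaceZ => //.
  by apply: PB; [apply: PB => //; exact: Pr | exact: Pl].
have DcD a b c : P (cmul (cmul (commutator y a) c) (commutator y b)).
  have -> : cmul (cmul (commutator y a) c) (commutator y b) =
     cmul (commutator y a) (commutator y (cmul c b))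
     - cmul (cmul (commutator y a) (commutator y c)) b by nc_ring.
  by apply: PB => //; exact: Pr.
case: hP => _ _ primeP a.
by have [] := primeP _ _ (DcD a a).
Qed.

(** A noncentral x in [K] forces [L, L] into [P]: expanding [y, [x, a d]] gives [y, a] [x, d] = 0
    modulo [P] for y, a in [L]. Then [y, -] squares to zero, and [central_mod_sq] applies. *)
Lemma commuting_lie_ideals K L : lie_ideal K -> lie_ideal L ->
  comm_span K L `<=` P -> K `<=` central_mod \/ L `<=` central_mod.
Proof.
move=> hK hL KL; have [|nK] := pselect (K `<=` central_mod); [by left|right].
have {KL}KL x y : K x -> L y -> P (commutator x y).
  by move=> Kx Ly; apply: KL; exact: comm_spanI.
have LK x y : K x -> L y -> P (commutator y x).
  by move=> Kx Ly; rewrite commutatorC; apply: (subspaceN hPs); exact: KL.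
have [x [Kx [b Pxb]]] : exists x, K x /\ exists b, ~ P (commutator x b).
  apply: contrapT => h; apply: nK => x Kx b; apply: contrapT => Pxb.
  by apply: h; exists x; split=> //; exists b.
have LL y a : L y -> L a -> P (commutator y a).
  move=> Ly La.
  have DD d : P (cmul (commutator y a) (commutator x d)).
    have -> : cmul (commutator y a) (commutator x d) =
      commutator y (commutator x (cmul a d))
      - cmul (commutator y (commutator x a)) d
      - cmul (commutator x a) (commutator y d)
      - cmul a (commutator y (commutator x d)) by nc_ring.
    have yx e : P (commutator y (commutator x e)).
      by apply: LK => //; exact: lie_ideal_commr.
    by apply: PB; [apply: PB; [apply: PB|]|];
      [exact: yx | exact/Pr/yx | exact/Pr/KL | exact/Pl/yx].
  suff [] : P (commutator y a) \/ P (commutator x b) by [].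
  case: hP => _ _; apply=> c.
  have -> : cmul (cmul (commutator y a) c) (commutator x b) =
      cmul (commutator y a) (commutator x (cmul c b))
      - cmul (cmul (commutator y a) (commutator x c)) b by nc_ring.
  by apply: PB => //; exact: Pr.
move=> y Ly; apply: central_mod_sq => a; apply: LL => //.
exact: lie_ideal_commr.
Qed.

(** Let z = [x, y]. Since [x, [y, y a]] = z [y, a] + y [x, [y, a]] is central modulo [P], commuting
    it with y leaves z [y, [y, a]] = 0. A central z outside [P] cancels, so that y is central and z
    is in [P] after all. *)
Lemma central_comm_span K L : lie_ideal K -> lie_ideal L ->
  comm_span K L `<=` central_mod -> comm_span K L `<=` P.
Proof.
move=> hK hL KL; apply: comm_span_min => // x y Kx Ly.
have {}KL u v : K u -> L v -> central_mod (commutator u v).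
  by move=> Ku Lv; apply: KL; exact: comm_spanI.
set z := commutator x y.
have zyy a : P (cmul z (commutator y (commutator y a))).
  pose w := commutator x (commutator y a).
  have Lya : L (commutator y a) by exact: lie_ideal_commr.
  have -> : cmul z (commutator y (commutator y a)) =
    cmul (commutator z y) (commutator y a) 
    + cmul y (commutator w y)
    - commutator (commutator x (commutator y (cmul y a))) y.
    by rewrite /z /w; nc_ring.
  apply: PB; first by apply: PD; [apply: Pr|apply: Pl]; exact: KL.
  by apply: KL => //; exact: lie_ideal_commr.
have zPv v : P (cmul z v) -> P z \/ P v.
  move=> zv; case: hP => _ _; apply=> c.
  have -> : cmul (cmul z c) v = cmul (commutator z c) v + cmul c (cmul z v).
    by nc_ring.
  by apply: PD; [apply/Pr/KL | exact: Pl].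
have [//|nz] := pselect (P z).
rewrite /z commutatorC; apply: (subspaceN hPs).
by apply: central_mod_sq => a; case: (zPv _ (zyy a)).
Qed.

End ModuloPrime.

End LieIdeals.

Theorem theoremC (R : realType) (A : cstarAlgType R) (K L : set A)
    (hK : lie_ideal K) (hL : lie_ideal L) :
  (generates_as_ideal (comm_span K L) <->
     generates_as_ideal (comm_span K K) /\ generates_as_ideal (comm_span L L))
  /\ (generates_as_ideal (comm_span K L) ->
       comm_span (@setT A) (@setT A) = comm_span K L).
Proof.
split; first split.
(* A prime ideal containing [K, K] makes K central modulo it and so contains [K, L]; likewise for
   L. *)
- move=> genKL; split.
    have [//|[P hP KKP]] := generates_or_prime (comm_span_subspace K K).
    case: (generates_not_prime genKL hP); apply: comm_span_centrall => //.
    by case: (commuting_lie_ideals hP hK hK KKP).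
  have [//|[P hP LLP]] := generates_or_prime (comm_span_subspace L L).
  case: (generates_not_prime genKL hP); apply: comm_span_centralr => //.
  by case: (commuting_lie_ideals hP hL hL LLP).
- move=> [genK genL].
  have [//|[P hP KLP]] := generates_or_prime (comm_span_subspace K L).
  have [KP|LP] := commuting_lie_ideals hP hK hL KLP.
    by case: (generates_not_prime genK hP); apply: comm_span_centrall.
  by case: (generates_not_prime genL hP); apply: comm_span_centrall.
- move=> genKL; set M := comm_span K L.
  have hM : lie_ideal M by exact: comm_span_lie_ideal.
  (* If a prime ideal contains [M, M], then M is central modulo it, and therefore contained in
     it. *)
  have genM : generates_as_ideal (comm_span M M).
    have [//|[P hP MMP]] := generates_or_prime (comm_span_subspace M M).
    case: (generates_not_prime genKL hP).
    apply: central_comm_span => //.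
    by case: (commuting_lie_ideals hP hM hM MMP).
  apply/seteqP; split; last exact: comm_spanS.
  exact: subset_trans (comm_span_generating hM genM) hM.2.
Qed.
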